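(* Let $q$ be a prime power, let $1<k<n-1$, and let $V=F_q^n$. Let $U\subseteq V$ be a $(k+1)$-dimensional non-degenerate linear code, and let $\langle U]^c_k$ denote the set of all $k$-dimensional subspaces of $U$ that are non-degenerate linear codes. Then $\langle U]^c_k$ is a maximal clique of the graph $\Gamma(n,k)_q$ if and only if $\langle U]^c_k$ is not contained in a line of $\mathcal G_k(V)$.
   Context: $F_q$ is the field with $q$ elements; $\mathcal G_k(V)$ is the set of all $k$-dimensional subspaces of $V$. For $i=1,\dots,n$, $C_i=\{x\in V: x_i=0\}$ is the $i$-th coordinate hyperplane. A subspace of $V$ is a non-degenerate linear code if it is not contained in any $C_i$. $\Gamma(n,k)_q$ is the graph whose vertices are the $k$-dimensional non-degenerate linear codes in $V$, two distinct vertices being adjacent iff their intersection has dimension $k-1$. A clique is a set of pairwise adjacent vertices; it is maximal if not properly contained in another clique. A line of $\mathcal G_k(V)$ is a set $\{K\in\mathcal G_k(V): S\subset K\subset T\}$ with $S\subset T$ subspaces, $\dim S=k-1$, $\dim T=k+1$. *)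

(* Defs.v *)
(* V = F_q^n is 'rV[F]_n for a finite field F, k-dimensional
   subspaces are {vspace 'rV[F]_n}, families of subspaces are classical sets. *)
From mathcomp Require Import all_boot all_algebra.
From mathcomp Require Import classical_sets.
Set Implicit Arguments.
Unset Strict Implicit.
Unset Printing Implicit Defensive.
Import GRing.Theory.
Local Open Scope classical_set_scope.
Local Open Scope ring_scope.

Section Graph.
Variables (T : Type) (vertex : set T) (adj : T -> T -> Prop).

Definition clique (A : set T) : Prop :=
  A `<=` vertex /\ forall x y, A x -> A y -> x <> y -> adj x y.

Definition maximal_clique (A : set T) : Prop :=
  clique A /\ forall B, clique B -> ~ (A `<` B).

End Graph.

Section Codes.
Variables (F : finFieldType) (n : nat).
Notation V := 'rV[F]_n.

Definition Grassmannian (k : nat) : set {vspace V} := [set K | \dim K = k].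

Definition coord_hyperplane (i : 'I_n) : set V := [set x | x ord0 i = 0].

Definition nondegenerate_code (U : {vspace V}) : Prop :=
  forall i : 'I_n, ~ ([set` U] `<=` coord_hyperplane i).

Definition code_vertex (k : nat) : set {vspace V} :=
  Grassmannian k `&` nondegenerate_code.

(* The dimension of the intersection is k - 1, written without truncated
   subtraction. *)
Definition code_adj (k : nat) (K L : {vspace V}) : Prop :=
  K <> L /\ (\dim (K :&: L)%VS).+1 = k.

Definition is_line (k : nat) (A : set {vspace V}) : Prop :=
  exists S T : {vspace V},
    [/\ (S <= T)%VS, (\dim S).+1 = k, \dim T = k.+1 &
        A = Grassmannian k `&` [set K | (S <= K)%VS /\ (K <= T)%VS]].

(* The set <U]^c_k. *)
Definition top_codes (k : nat) (U : {vspace V}) : set {vspace V} :=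
  [set K | (K <= U)%VS] `&` code_vertex k.

End Codes.

Arguments code_vertex : clear implicits.
Arguments code_adj : clear implicits.

(* Main.v *)
(* Two distinct [k]-subspaces of [U] meet in dimension [k - 1], so the codes
   inside [U] form a clique.  A vertex [X] outside [U] adjacent to all of them
   meets each of them in [U :&: X], so they all lie on the line from [U :&: X]
   to [U].
   Conversely, let all codes of [U] contain a subspace [S] of dimension [k - 1],
   let [K] be one of them, and [v \in K] with [v \notin S].  If some unit vector
   [e_m] is not in [U] while the [m]-th coordinate does not vanish on [S], then
   [S + <v + e_m>] is a code outside [U] that extends the clique.  Otherwise [U]
   contains all such [e_m], and for [m] such a coordinate and [i] a coordinate
   vanishing on [S], the hyperplane [x_m = x_i] of [U] is a code that does not
   contain [S], which is impossible.
   [U] may contain no code at all (e.g. over F_2); both sides then fail, since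
   the empty clique extends to any single vertex. *)
From HB Require Import structures.
Require Import Defs.
From mathcomp Require Import all_boot all_algebra.
From mathcomp Require Import boolp classical_sets.
Local Open Scope classical_set_scope.
Local Open Scope ring_scope.
Import GRing.Theory.

(** * Dimension counts for sums, intersections and hyperplanes *)

Section Subspaces.
Set Implicit Arguments.
Unset Strict Implicit.
Variables (K : fieldType) (vT : vectType K).
Implicit Types (A B C S U : {vspace vT}) (v : vT).

Lemma dimv_add_line S v : v \notin S -> \dim (S + <[v]>) = (\dim S).+1.
Proof.
move=> vS; have v0 : v != 0 by apply: contraNneq vS => ->; rewrite mem0v.
rewrite dimv_disjoint_sum ?dim_vline ?v0 ?addn1 //.
apply/eqP; rewrite -subv0; apply/subvP => x /memv_capP[xS /vlineP[c xE]].
rewrite memv0; have [c0|c0] := eqVneq c 0; first by rewrite xE c0 scale0r.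
by case/negP: vS; rewrite -(scalerK c0 v) -xE memvZ.
Qed.

Lemma ex_subspace_dim A B d : (A <= B)%VS -> (\dim A <= d <= \dim B)%N ->
  exists C, [/\ (A <= C)%VS, (C <= B)%VS & \dim C = d].
Proof.
move=> AB /andP[]; elim: d => [|d IH].
  by rewrite leqn0 => /eqP A0 _; exists A.
rewrite leq_eqVlt => /orP[/eqP AE _|Ad dB]; first by exists A.
have [C [AC CB dC]] := IH Ad (ltnW dB).
have /subvPn[v vB vC] : ~~ (B <= C)%VS.
  by apply/negP => /dimvS; rewrite dC leqNgt dB.
exists (C + <[v]>)%VS; split; last by rewrite dimv_add_line ?dC.
  exact: subv_trans AC (addvSl _ _).
by rewrite subv_add CB -memvE.
Qed.

(** Distinct subspaces of equal dimension have a sum larger than either, so here [A + B] fills [U];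
    the dimension formula does the rest. *)
Lemma dim_cap_hyperplanes A B U d : (A <= U)%VS -> (B <= U)%VS -> A != B ->
  \dim A = d -> \dim B = d -> \dim U = d.+1 -> (\dim (A :&: B)).+1 = d.
Proof.
move=> AU BU AB dA dB dU.
have dlt : (d < \dim (A + B))%N.
  rewrite -dA ltnNge; apply: contraNN AB => le_dim.
  have /eqP AE : A == (A + B)%VS by rewrite eqEdim addvSl.
  by rewrite eq_sym eqEdim dA dB leqnn andbT AE addvSr.
have dD : \dim (A + B) = d.+1.
  by apply/eqP; rewrite eqn_leq dlt -dU dimvS // subv_add AU.
by move: (dimv_sum_cap A B); rewrite dD dA dB addSn -addnS => /addnI.
Qed.

(** Rank-nullity on [U]: the image is a nonzero subspace of the one-dimensional [K^o]. *)
Lemma dim_cap_lker U (f : 'Hom(vT, K^o)) v : v \in U -> f v != 0 ->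
  (\dim (U :&: lker f)).+1 = \dim U.
Proof.
move=> vU fv; rewrite -(limg_ker_dim f U) -addn1; congr (_ + _)%N.
apply/esym/eqP; rewrite eqn_leq; apply/andP; split.
  by rewrite (leq_trans (dimvS (subvf _))) // dimvf.
rewrite lt0n dimv_eq0; apply: contraNneq fv => fU.
by rewrite -memv0 -fU memv_img.
Qed.

End Subspaces.

(** * Non-degenerate codes, cliques and lines *)

Section Codes.
Set Implicit Arguments.
Unset Strict Implicit.
Variables (F : finFieldType) (n : nat).
Notation V := 'rV[F]_n.
Implicit Types (K S U X : {vspace V}) (i j m : 'I_n) (k : nat).

Lemma nondegenerate_codeP U :
  nondegenerate_code U <-> forall i, exists2 x, x \in U & x 0 i != 0.
Proof.
split=> [ndU i|ndU i /(_ _ _)Ui]; last first.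
  by have [x xU] := ndU i; rewrite (Ui x xU) eqxx.
apply: contrapT => none; apply: (ndU i) => x xU.
by apply/eqP/negP => /negP xi; apply: none; exists x.
Qed.

Lemma delta_span U : (forall i, delta_mx 0 i \in U) -> U = fullv.
Proof.
move=> eU; apply/vspaceP => x; rewrite memvf.
by rewrite (row_sum_delta x) memv_suml // => i _; rewrite memvZ.
Qed.

(** Every subspace through the all-ones vector is non-degenerate. *)
Lemma ex_code_vertex k : (0 < k <= n)%N -> exists K, code_vertex F n k K.
Proof.
move=> /andP[k0 kn].
have [|C [aC _ dC]] := @ex_subspace_dim F V <[const_mx 1]>%VS fullv k (subvf _).
  by rewrite dimvf /dim /= mul1n kn andbT (leq_trans _ k0) // dim_vline leq_b1.
exists C; split => //; apply/nondegenerate_codeP => i.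
by exists (const_mx 1); rewrite ?mxE ?oner_eq0 // memvE.
Qed.

Lemma top_codes_clique k U : \dim U = k.+1 ->
  clique (code_vertex F n k) (code_adj F n k) (top_codes k U).
Proof.
move=> dU; split=> [K [] //|K L [KU [dK _]] [LU [dL _]] /eqP KL].
by split; [apply/eqP | exact: (dim_cap_hyperplanes KU LU KL dK dL dU)].
Qed.

Lemma clique_setU1 k (A : set {vspace V}) X :
  clique (code_vertex F n k) (code_adj F n k) A -> code_vertex F n k X ->
  (forall K, A K -> code_adj F n k K X) ->
  clique (code_vertex F n k) (code_adj F n k) (A `|` [set X]).
Proof.
move=> [Av Aadj] Xv AX; split=> [K [/Av //|-> //]|K L [AK|->] [AL|->] KL] //.
- exact: Aadj.
- exact: AX.
- by have [_ dLX] := AX _ AL; split=> //; rewrite capvC.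
Qed.

Lemma top_codes_in_line k S U : (S <= U)%VS -> (\dim S).+1 = k ->
  \dim U = k.+1 -> (forall K, top_codes k U K -> (S <= K)%VS) ->
  exists A, is_line k A /\ top_codes k U `<=` A.
Proof.
move=> SU dS dU sS.
exists (Grassmannian (n := n) k `&` [set K | (S <= K)%VS /\ (K <= U)%VS]).
split; first by exists S, U.
by move=> K topK; have [KU [dK _]] := topK; split=> //; split=> //; exact: sS.
Qed.

Lemma top_codes_adj_in_line k U X : (0 < k)%N -> \dim U = k.+1 ->
  code_vertex F n k X -> ~~ (X <= U)%VS ->
  (forall K, top_codes k U K -> code_adj F n k K X) ->
  exists A, is_line k A /\ top_codes k U `<=` A.
Proof.
move=> k0 dU [dX _] XU adjX.
(* If [U] contains no code, any [S] of dimension [k - 1] in [U] gives a suitable line. *)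
have [[K0 topK0]|none] := pselect (exists K, top_codes k U K); last first.
  have [|S [_ SU dS]] := @ex_subspace_dim F V 0%VS U k.-1 (sub0v _).
    by rewrite dimv0 dU leqW // leq_pred.
  apply: (top_codes_in_line SU _ dU) => [|K topK]; first by rewrite dS prednK.
  by case: none; exists K.
have capE K : top_codes k U K -> (K :&: X = U :&: X)%VS.
  move=> topK; have [_ dKX] := adjX _ topK; have [KU _] := topK.
  (* [K :&: X] has dimension [k - 1], and [U :&: X], being proper in [X], has no more. *)
  apply/eqP; rewrite eqEdim capvS //= -ltnS dKX -dX ltnNge.
  apply: contra XU => le_dim.
  have /eqP <- : (U :&: X)%VS == X by rewrite eqEdim capvSr.
  exact: capvSl.
apply: (top_codes_in_line (capvSl U X) _ dU) => [|K topK].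
  by rewrite -(capE _ topK0); have [] := adjX _ topK0.
by rewrite -(capE _ topK) capvSl.
Qed.

(** * Codes through a common subspace of dimension [k - 1] *)

Lemma code_adj_star k S K X : (\dim S).+1 = k -> (S <= K)%VS -> (S <= X)%VS ->
  \dim K = k -> \dim X = k -> K != X -> code_adj F n k K X.
Proof.
move=> dS SK SX dK dX KX; split; first exact/eqP.
apply/eqP; rewrite eqn_leq -{2}dS ltnS dimvS ?subv_cap ?SK // andbT.
rewrite ltnNge; apply: contra KX => le_dim.
have /eqP KE : (K :&: X)%VS == K by rewrite eqEdim capvSl dK.
by rewrite eqEdim dK dX leqnn andbT -{1}KE capvSr.
Qed.

(** Replacing [v] by [v + e_m] leaves [U] and changes only coordinate [m], where [S] is already
    nonzero, so non-degeneracy survives. *)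
Lemma ex_code_outside_star k S U v m :
  (\dim S).+1 = k -> (S <= U)%VS -> v \in U -> v \notin S ->
  nondegenerate_code (S + <[v]>)%VS ->
  (exists2 s, s \in S & s 0 m != 0) -> delta_mx 0 m \notin U ->
  exists X, [/\ code_vertex F n k X, (S <= X)%VS & ~~ (X <= U)%VS].
Proof.
move=> dS SU vU vS /nondegenerate_codeP ndK [s sS sm] emU.
set w := v + delta_mx 0 m.
have wU : w \notin U.
  by apply: contra emU => wU; rewrite -(addKr v (delta_mx 0 m)) memvD ?memvN.
have wS : w \notin S by apply: contra wU; apply: subvP.
exists (S + <[w]>)%VS; split; last 2 first.
- exact: addvSl.
- by rewrite subv_add SU -memvE.
split; first by rewrite /Grassmannian /= dimv_add_line.
apply/nondegenerate_codeP => i.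
have [->|im] := eqVneq i m.
  by exists s => //; rewrite (subvP (addvSl _ _)).
have [_ /memv_addP[x xS [_ /vlineP[c ->] ->]] xi] := ndK i.
exists (x + c *: w); first by rewrite memv_add // memvZ // memv_line.
by move: xi; rewrite !mxE (negPf im) andbF addr0.
Qed.

(** The witness is the hyperplane [x_m = x_i] of [U]; a vector of [S] with nonzero [m]-th coordinate
    is not in it, since its [i]-th coordinate is zero. *)
Lemma ex_top_code_not_containing k S U v m i :
  \dim U = k.+1 -> v \in U ->
  (forall j, (exists2 s, s \in S & s 0 j != 0) -> delta_mx 0 j \in U) ->
  (forall j, (exists2 s, s \in S & s 0 j != 0) \/ v 0 j != 0) ->
  (exists2 s, s \in S & s 0 m != 0) ->
  ~ (exists2 s, s \in S & s 0 i != 0) ->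
  exists K, top_codes k U K /\ ~~ (S <= K)%VS.
Proof.
move=> dU vU eU ndS Sm Si.
pose g (x : V) : F^o := x 0 m - x 0 i.
have g_lin : linear g by move=> c x y; rewrite /g !mxE opprD scalerBr addrACA.
pose g_ext := GRing.isLinear.Build F V F^o *:%R g g_lin.
pose f : 'Hom(V, F^o) := linfun (HB.pack_for {linear V -> F^o} g g_ext).
have fE x : f x = x 0 m - x 0 i by rewrite lfunE.
have memK x : (x \in (U :&: lker f)%VS) = (x \in U) && (x 0 m == x 0 i).
  by rewrite memv_cap memv_ker fE subr_eq0.
have emU := eU _ Sm.
have im : i != m by apply/eqP => im; apply: Si; rewrite im.
have vi : v 0 i != 0 by case: (ndS i).
exists (U :&: lker f)%VS; split; last first.
  case: Sm => s sS sm; apply/negP => /subvP/(_ s sS); rewrite memK => /andP[_].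
  by apply/negP; apply: contra_notN Si => /eqP smi; exists s; rewrite -?smi.
split; first exact: capvSl.
have fem : f (delta_mx 0 m) != 0.
  by rewrite fE !mxE !eqxx (negPf im) subr0 oner_eq0.
split; first by apply/succn_inj; rewrite (dim_cap_lker emU fem).
apply/nondegenerate_codeP => j.
(* For [j] other than [m] and not vanishing on [S], [e_j] itself lies in the hyperplane, as [j] also
   differs from [i]. *)
have [[Sj jm]|jP] := pselect ((exists2 s, s \in S & s 0 j != 0) /\ j != m).
  have ij : i != j by apply/eqP => ij; apply: Si; rewrite ij.
  exists (delta_mx 0 j); last by rewrite mxE !eqxx oner_eq0.
  by rewrite memK eU // !mxE (negPf ij) (eq_sym m) (negPf jm) eqxx.
(* This is [v] with its [m]-th coordinate reset to [v_i], which is nonzero because [S] vanishes at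
   [i]. *)
exists (v + (v 0 i - v 0 m) *: delta_mx 0 m).
  rewrite memK memvD ?memvZ //= !mxE !eqxx (negPf im).
  by rewrite mulr1 mulr0 addr0 addrC subrK.
rewrite !mxE eqxx; have [->|jm] := eqVneq j m.
  by rewrite mulr1 addrC subrK.
by rewrite mulr0 addr0; case: (ndS j) => // Sj; case: jP.
Qed.

End Codes.

Theorem theorem2 (F : finFieldType) (n k : nat) (hk : (1 < k)%N)
    (hkn : (k < n - 1)%N) (U : {vspace 'rV[F]_n}) (hU : \dim U = k.+1)
    (hUnd : nondegenerate_code U) :
  maximal_clique (code_vertex F n k) (code_adj F n k) (top_codes k U) <->
  ~ (exists L : set {vspace 'rV[F]_n}, is_line k L /\ top_codes k U `<=` L).
Proof.
have k0 : (0 < k)%N by apply: ltnW.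
split=> [[topC topM] [_ [[S [T [ST dS dT ->]]] topL]]|noL]; last first.
  split=> [|B [Bv Badj] [topB Btop]]; first exact: top_codes_clique.
  apply: Btop => X BX; have Xv := Bv _ BX; split=> //=.
  apply: contrapT => /negP XU.
  apply/noL/(top_codes_adj_in_line k0 hU Xv XU) => K topK.
  apply: Badj => //; first exact: topB.
  by move=> KX; move: XU; rewrite -KX; have [-> _] := topK.
(* Maximality in usable form: no vertex outside [U] is adjacent to all codes of [U]. *)
have noX X : code_vertex F n k X -> ~~ (X <= U)%VS ->
    ~ (forall K, top_codes k U K -> code_adj F n k K X).
  move=> Xv XU adjX; apply: (topM _ (clique_setU1 topC Xv adjX)).
  split=> [|sub]; first exact: subsetUl.
  by move: XU; have [-> _] := sub X (or_intror erefl).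
have [[K0 topK0]|none] := pselect (exists K, top_codes k U K); last first.
  have [|X Xv] := @ex_code_vertex F n k.
    by rewrite k0 (leq_trans (ltnW hkn)) // leq_subr.
  have noK K : ~ top_codes k U K by move=> topK; apply: none; exists K.
  apply: (noX X Xv) => [|K /noK //].
  by apply/negP => XU; apply: (noK X).
have sS K : top_codes k U K -> (S <= K)%VS by case/topL => _ [].
have [K0U [dK0 ndK0]] := topK0; have SK0 := sS _ topK0.
have SU := subv_trans SK0 K0U.
have /subvPn[v vK0 vS] : ~~ (K0 <= S)%VS.
  by apply/negP => /dimvS; rewrite dK0 -dS ltnn.
have vU := subvP K0U _ vK0.
have K0E : K0 = (S + <[v]>)%VS.
  apply/esym/eqP; rewrite eqEdim subv_add SK0 -memvE vK0 /=.
  by rewrite dimv_add_line // dS dK0.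
have eU j : (exists2 s, s \in S & s 0 j != 0) -> delta_mx 0 j \in U.
  move=> Sj; apply: contrapT => /negP ejU.
  rewrite K0E in ndK0.
  have [X [Xv SX XU]] := ex_code_outside_star dS SU vU vS ndK0 Sj ejU.
  apply: (noX X Xv XU) => K topK; have [KU [dK _]] := topK; have [dX _] := Xv.
  by apply: (code_adj_star dS (sS _ topK) SX dK dX); apply: contraNneq XU => <-.
(* Some [s + c v] in [K0] is nonzero at [j], so [s] or [v] is. *)
have ndS j : (exists2 s, s \in S & s 0 j != 0) \/ v 0 j != 0.
  have /nondegenerate_codeP/(_ j)[x] := ndK0.
  rewrite K0E => /memv_addP[s sS' [_ /vlineP[c ->] ->]].
  rewrite !mxE; have [->|sj _] := eqVneq (s 0 j) 0; last by left; exists s.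
  by rewrite add0r mulf_eq0 negb_or => /andP[]; right.
(* [S] is nonzero because [1 < k]. *)
have [m Sm] : exists m, exists2 s, s \in S & s 0 m != 0.
  have /subvPn[s sS' s0] : ~~ (S <= 0)%VS.
    by rewrite subv0 -dimv_eq0 -lt0n -ltnS dS.
  move: s0; rewrite memv0 => /rV0Pn[m sm].
  by exists m, s.
(* Otherwise [U] contains every unit vector and is the whole space, against [k + 1 < n]. *)
have [i Si] : exists i, ~ exists2 s, s \in S & s 0 i != 0.
  apply: contrapT => noi.
  have UV : U = fullv.
    apply: delta_span => j; apply: eU; apply: contrapT => Sj.
    by apply: noi; exists j.
  move: hkn; rewrite ltnNge leq_subLR add1n -hU UV dimvf /dim /= mul1n leqnn.
  by [].
have [K [topK]] := ex_top_code_not_containing hU vU eU ndS Sm Si.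
by rewrite (sS K topK).
Qed.
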